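(* Let $u$ and $v$ be nonadjacent (distinct) vertices of a graph $G$, and let $k \geq 0$ be an integer. If $\gamma(G_{u,v,k}) = \gamma(G)$ then $k \leq 4$. If $k \geq 5$ then $\gamma(G_{u,v,k}) > \gamma(G)$. If $\gamma(G_{u,v,4}) = \gamma(G)$ then $\gamma(G_{u,v,5}) = \gamma(G)+1$.
   Context: Graphs are finite and simple. $\gamma(H)$ denotes the domination number of a graph $H$. For distinct vertices $u,v$ of $G$ and an integer $k\geq 0$, $G_{u,v,k}$ denotes the graph obtained from the disjoint union of $G$ and a path $x_0,x_1,\dots,x_{k+1}$ by identifying $u$ with $x_0$ and $v$ with $x_{k+1}$ (so $k$ new vertices $x_1,\dots,x_k$ are added; $G_{u,v,0}$ is $G$ with the edge $uv$ added). *)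

(* Defs.v *)
(* Mathematical Components. *)
From mathcomp Require Import all_boot.

Set Implicit Arguments.
Unset Strict Implicit.
Unset Printing Implicit Defensive.

(* A finite simple graph is a symmetric irreflexive relation on a finType. *)

Definition dominating (T : finType) (e : rel T) (D : {set T}) : bool :=
  [forall x, (x \in D) || [exists y in D, e x y]].

Lemma dominatingT (T : finType) (e : rel T) : dominating e [set: T].
Proof. by apply/forallP => x; rewrite inE. Qed.

(* [set: T] always dominates, so the minimum below is a genuine one. *)
Definition domination_number (T : finType) (e : rel T) : nat :=
  #|[arg min_(D < [set: T] | dominating e D) #|D| ]|.

Lemma domination_numberP (T : finType) (e : rel T) :
  (exists2 D, dominating e D & #|D| = domination_number e) /\
  (forall D, dominating e D -> domination_number e <= #|D|).
Proof.
rewrite /domination_number; case: arg_minnP => [|D domD minD].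
  exact: dominatingT.
by split; [exists D | exact: minD].
Qed.

(* The vertices x_0, ..., x_{k+1} of the path, after the identifications
   x_0 = u and x_{k+1} = v; the new vertex x_{j+1}, j < k, is inr j. *)
Definition path_vertex (T : finType) (u v : T) (k i : nat) : T + 'I_k :=
  if i is j.+1 then
    if insub j is Some o then inr o else inl v
  else inl u.

(* Adjacency of the graph G_{u,v,k} on the vertex type T + 'I_k. *)
Definition add_path (T : finType) (e : rel T) (u v : T) (k : nat) :
    rel (T + 'I_k) :=
  fun a b =>
    (if (a, b) is (inl x, inl y) then e x y else false)
    || [exists i : 'I_k.+1,
          let s := path_vertex u v k i in
          let t := path_vertex u v k i.+1 in
          ((a == s) && (b == t)) || ((a == t) && (b == s))].
Arguments add_path {T} e u v k _ _.

Lemma add_path_sym (T : finType) (e : rel T) (u v : T) (k : nat) :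
  symmetric e -> symmetric (add_path e u v k).
Proof.
move=> sym_e a b; rewrite /add_path; congr orb.
  by case: a => x; case: b => y //=; rewrite sym_e.
by apply: eq_existsb => i /=; rewrite orbC andbC [X in _ || X]andbC.
Qed.

Lemma add_path_irrefl (T : finType) (e : rel T) (u v : T) (k : nat) :
  irreflexive e -> u != v -> irreflexive (add_path e u v k).
Proof.
move=> irr_e neq_uv a; rewrite /add_path.
have -> : (if (a, a) is (inl x, inl y) then e x y else false) = false.
  by case: a => x //=; rewrite irr_e.
apply/existsP => -[i] /=; rewrite [X in _ || X]andbC orbb.
move=> /andP[/eqP-> ]; case: i => -[|i] lt_i /=.
  by case: insubP => [//|_ /eqP[] /eqP]; rewrite (negPf neq_uv).
case: insubP => [o _ o_i|]; last by rewrite -ltnS lt_i.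
case: insubP => [o' _ o'_i|//] /eqP[] oo'.
by move: o'_i; rewrite -oo' o_i => /eqP; rewrite ltn_eqF.
Qed.

(* Main.v *)
(* Let D dominate G_{u,v,k} with k >= 5.  Some m in D among x_2, x_3, x_4
   dominates x_3; moving x_1 to u and every other new vertex of D to v turns
   D minus m into a dominating set of G, because m is adjacent to neither u nor
   v.  Hence gamma(G) < gamma(G_{u,v,k}).  Conversely, subdividing the last edge
   of the path and adding the subdivision vertex to a dominating set keeps it
   dominating, so gamma(G_{u,v,k+1}) <= gamma(G_{u,v,k}) + 1. *)
Require Import Defs.
From mathcomp Require Import all_boot.

Section AddPath.

Variables (T : finType) (e : rel T) (u v : T).

Lemma dominatingP (S : finType) (r : rel S) (D : {set S}) :
  reflect (forall x, x \in D \/ exists2 y, y \in D & r x y) (dominating r D).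
Proof.
apply: (iffP forallP) => domD x.
  by case/orP: (domD x) => [|/exists_inP]; [left | right].
by apply/orP; case: (domD x) => [|/exists_inP]; [left | right].
Qed.

Lemma path_vertex_inr k (j : 'I_k) : path_vertex u v k j.+1 = inr j.
Proof. by rewrite /path_vertex valK. Qed.

Lemma path_vertex_last k : path_vertex u v k k.+1 = inl v.
Proof. by rewrite /path_vertex insubF ?ltnn. Qed.

Lemma path_vertex_eq_inr k i (j : 'I_k) :
  path_vertex u v k i = inr j -> i = j.+1.
Proof. by case: i => //= i; case: insubP => // o _ <- [->]. Qed.

(** The bound on [i] matters: [insub] fails at every index above [k], so [path_vertex] takes the
    default value [v] at all of them, and only the bound singles out [k.+1]. *)
Lemma path_vertex_eq_inl k i x : i <= k.+1 ->
  path_vertex u v k i = inl x -> (i = 0 /\ x = u) \/ (i = k.+1 /\ x = v).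
Proof.
case: i => [|i] /= le_ik; first by case=> ->; left.
case: insubP => // ge_ik [->]; right; split=> //; congr S.
by apply/eqP; rewrite eqn_leq -ltnS le_ik leqNgt.
Qed.

(** Path edges are recorded by their position [i], once per orientation, so that case analysis on an
    adjacency yields the index for arithmetic. *)
Variant add_path_spec k : T + 'I_k -> T + 'I_k -> Prop :=
| AddPathEdge x y of e x y : add_path_spec k (inl x) (inl y)
| AddPathSucc i of i <= k :
    add_path_spec k (path_vertex u v k i) (path_vertex u v k i.+1)
| AddPathPred i of i <= k :
    add_path_spec k (path_vertex u v k i.+1) (path_vertex u v k i).

Lemma add_pathP k a b : reflect (add_path_spec k a b) (add_path e u v k a b).
Proof.
apply: (iffP orP) => [[]|].
- by case: a => x //; case: b => y // exy; constructor.
- case/existsP=> i /orP[]/andP[/eqP-> /eqP->]; constructor;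
    by rewrite -ltnS ltn_ord.
case=> [x y|i le_ik|i le_ik]; first by left.
all: right; apply/existsP; exists (Ordinal (le_ik : i < k.+1)).
all: by rewrite /= !eqxx ?orbT.
Qed.

Lemma add_path_inlr k x (j : 'I_k) :
  add_path e u v k (inl x) (inr j) ->
  (j = 0 :> nat /\ x = u) \/ (j.+1 = k /\ x = v).
Proof.
move/add_pathP.
move Ea: (inl x) => a; move Eb: (inr j) => b adj_ab.
case: adj_ab Ea Eb => // i le_ik /esym Ea /esym/path_vertex_eq_inr Eb.
  case/path_vertex_eq_inl: Ea => [|[i0 ->]|[ik ->]]; first exact: leqW.
    by left; split=> //; move: Eb; rewrite i0 => -[].
  by move: le_ik; rewrite ik ltnn.
case/path_vertex_eq_inl: Ea => // -[ik ->]; right; split=> //.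
by rewrite -Eb; case: ik.
Qed.

(** When [k] is positive, every path edge has a new endpoint: an edge that starts at [u] ends at
    [x_1]. For [k = 0] the path would itself be the edge [uv]. *)
Lemma add_path_inll k x y :
  0 < k -> add_path e u v k (inl x) (inl y) -> e x y.
Proof.
move=> k_gt0 /add_pathP.
have no_edge i z t : i <= k ->
    path_vertex u v k i = inl z -> path_vertex u v k i.+1 = inl t -> False.
  move=> le_ik /path_vertex_eq_inl[|[i0 _]|[ik _]]; first exact: leqW.
    by rewrite i0 -[1]/((Ordinal k_gt0).+1) path_vertex_inr.
  by move: le_ik; rewrite ik ltnn.
move Ea: (inl x) => a; move Eb: (inl y) => b adj_ab.
case: adj_ab Ea Eb => [x' y' exy [->] [->] //|i le_ik Ea Eb|i le_ik Ea Eb].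
  by case: (no_edge i x y).
by case: (no_edge i y x).
Qed.

Lemma add_path_inrr k (i j : 'I_k) :
  add_path e u v k (inr i) (inr j) -> i = j.+1 :> nat \/ j = i.+1 :> nat.
Proof.
move/add_pathP.
move Ea: (inr i) => a; move Eb: (inr j) => b adj_ab.
case: adj_ab Ea Eb => // n _ /esym/path_vertex_eq_inr Ea.
  by move=> /esym/path_vertex_eq_inr; rewrite Ea => -[->]; right.
by move=> /esym/path_vertex_eq_inr Eb; left; case: Ea => <-.
Qed.

Lemma domination_number_add_path_gt k : symmetric e -> 5 <= k ->
  domination_number e < domination_number (add_path e u v k).
Proof.
move=> e_sym k_ge5; have k_gt2 : 2 < k by apply: leq_trans k_ge5.
have [[D domD <-] _] := domination_numberP (add_path e u v k).
have [_ minG] := domination_numberP e.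
have {}domD := dominatingP _ _ _ domD.
(* Indices are shifted by one: [inr 2] is [x_3], and [0 < m < 4] describes [x_2, x_3, x_4]. An old
   vertex could dominate [x_3] only if [x_3] were an end of the new segment, which [k >= 5]
   excludes. *)
have [m mD /andP[m_gt0 m_lt4]] :
    exists2 m : 'I_k, inr m \in D & 0 < m < 4.
  case: (domD (inr (Ordinal k_gt2))) => [|[[y|j] yD]].
  - by exists (Ordinal k_gt2).
  - rewrite add_path_sym // => /add_path_inlr[[]//|[k_eq _]].
    by have := leq_trans k_ge5 (eq_leq (esym k_eq)).
  case/add_path_inrr => /= j_eq; exists j => //; last by rewrite j_eq.
  by case: j_eq => <-.
pose f (a : T + 'I_k) :=
  match a with inl x => x | inr j => if val j == 0 then u else v end.
rewrite (cardsD1 (inr m) D) mD ltnS; set E := D :\ _.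
apply: leq_trans (leq_imset_card f E); apply: minG; apply/dominatingP => x.
case: (domD (inl x)) => [xD|[[y|j] yD adj_xy]].
- by left; apply/imsetP; exists (inl x); rewrite // !inE.
- right; exists y; first by apply/imsetP; exists (inl y); rewrite // !inE.
  by apply: add_path_inll adj_xy; apply: leq_trans k_ge5.
(* A vertex [x] of [G] dominated by a new vertex is [u] or [v], and it is the image under [f] of
   that new vertex; [k >= 5] keeps index [k - 1] away from 0. *)
left; apply/imsetP; exists (inr j); last first.
  case/add_path_inlr: adj_xy => -[j_eq ->] /=; first by rewrite j_eq.
  case: eqP => // j0; have := leq_trans k_ge5 (eq_leq (esym j_eq)).
  by rewrite j0.
(* The removed vertex is not the one used: [j] is 0 or [k - 1 >= 4], whereas [m] lies strictly
   between 0 and 4. *)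
rewrite !inE yD andbT; apply/eqP => -[jm].
case/add_path_inlr: adj_xy => -[j_eq _]; first by rewrite -jm j_eq in m_gt0.
have := leq_trans k_ge5 (eq_leq (esym j_eq)).
by rewrite jm ltnS leqNgt m_lt4.
Qed.

Lemma domination_number_add_pathS k :
  domination_number (add_path e u v k.+1) <=
  (domination_number (add_path e u v k)).+1.
Proof.
have [[D domD <-] _] := domination_numberP (add_path e u v k).
have [_ minS] := domination_numberP (add_path e u v k.+1).
have {}domD := dominatingP _ _ _ domD.
pose g (a : T + 'I_k) : T + 'I_k.+1 :=
  match a with inl x => inl x | inr j => inr (widen_ord (leqnSn k) j) end.
(* The two paths agree up to position [k]; at [k.+1] the old one is already at [v], the new one at
   the subdivision vertex [ord_max]. *)
have gE i : i <= k -> path_vertex u v k.+1 i = g (path_vertex u v k i).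
  case: i => [|i] // lt_ik.
  rewrite (path_vertex_inr k (Ordinal lt_ik)).
  exact: (path_vertex_inr k.+1 (widen_ord (leqnSn k) (Ordinal lt_ik))).
have maxE : path_vertex u v k.+1 k.+1 = inr ord_max.
  exact: (path_vertex_inr k.+1 ord_max).
have domg a : g a \in inr ord_max |: g @: D \/
    exists2 b, b \in inr ord_max |: g @: D & add_path e u v k.+1 (g a) b.
  case: (domD a) => [aD|[b bD adj_ab]].
    by left; rewrite setU1r ?imset_f.
  right; case/add_pathP: adj_ab bD => [x y exy|i le_ik|i le_ik] bD.
  - exists (inl y); first by rewrite setU1r // (imset_f g bD).
    by apply/add_pathP; constructor.
  (* Edges at positions [i < k] survive the subdivision. The edge at position [k] is the subdivided
     one, and both its ends are now adjacent to [ord_max]. *)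
  - have [lt_ik|ge_ik] := ltnP i k.
      exists (g (path_vertex u v k i.+1)); first by rewrite setU1r ?imset_f.
      by apply/add_pathP; rewrite -!gE //; constructor; apply: leqW.
    exists (inr ord_max); first exact: setU11.
    have -> : i = k by apply/eqP; rewrite eqn_leq le_ik.
    by apply/add_pathP; rewrite -gE // -maxE; constructor.
  have [lt_ik|ge_ik] := ltnP i k.
    exists (g (path_vertex u v k i)); first by rewrite setU1r ?imset_f.
    by apply/add_pathP; rewrite -!gE //; constructor; apply: leqW.
  exists (inr ord_max); first exact: setU11.
  have -> : i = k by apply/eqP; rewrite eqn_leq le_ik.
  apply/add_pathP; rewrite path_vertex_last /= -(path_vertex_last k.+1) -maxE.
  by constructor.
apply: (@leq_trans #|inr ord_max |: g @: D|); last first.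
  by rewrite cardsU1; apply: (leq_add (leq_b1 _) (leq_imset_card g D)).
apply/minS/dominatingP => -[x|j]; first exact: (domg (inl x)).
have [lt_jk|ge_jk] := ltnP j k.
  have -> : inr j = g (inr (Ordinal lt_jk)) by congr inr; apply: val_inj.
  exact: domg.
left; have -> : j = ord_max; last exact: setU11.
by apply/val_inj/eqP; rewrite eqn_leq ge_jk -ltnS ltn_ord.
Qed.

End AddPath.

Theorem theorem21 (T : finType) (e : rel T)
    (e_sym : symmetric e) (e_irr : irreflexive e)
    (u v : T) (neq_uv : u != v) (nadj_uv : ~~ e u v) (k : nat) :
  [/\ domination_number (add_path e u v k) = domination_number e -> k <= 4,
      5 <= k ->
        domination_number e < domination_number (add_path e u v k)
    & domination_number (add_path e u v 4) = domination_number e ->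
        domination_number (add_path e u v 5) = domination_number e + 1].
Proof.
have gt_add n := domination_number_add_path_gt T e u v n e_sym.
split=> [eq_k|/gt_add//|eq_4].
  by rewrite leqNgt; apply/negP => /gt_add; rewrite eq_k ltnn.
(* The strict bound at [k = 5] gives one inequality, a single subdivision from [k = 4] the other. *)
apply/eqP; rewrite addn1 eqn_leq gt_add // andbT -eq_4.
exact: domination_number_add_pathS.
Qed.
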